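(* Let $A \in \mathbb{C}^{n \times n}$ be a skew-Hermitian matrix (i.e. $A^{\ast} = -A$), and let $\operatorname{inertia}(A) = i\,(n_{-}, n_0, n_{+})$ be such that neither $n_{-} = n$ nor $n_{+} = n$. Put $n_1 = \min(n_{-}, n_{+})$ and $n_2 = \max(n_{-}, n_{+}) - n_1$. Then there exists a unitary matrix $Q \in \mathbb{C}^{n \times n}$ such that $$M = Q^{\ast} A Q = \begin{bmatrix} 0 & 0 & 0 & 0 \\ 0 & 0 & 0 & -Y^{\ast} \\ 0 & 0 & X & -Z^{\ast} \\ 0 & Y & Z & W \end{bmatrix},$$ with diagonal blocks of orders $n_0, n_1, n_2, n_1$ respectively, where $Y \in \mathbb{C}^{n_1 \times n_1}$ is nonsingular and lower antitriangular, $W \in \mathbb{C}^{n_1 \times n_1}$ and $X \in \mathbb{C}^{n_2 \times n_2}$ are skew-Hermitian, and $Z \in \mathbb{C}^{n_1 \times n_2}$. Moreover, either $\operatorname{inertia}(X) = i\,(n_2, 0, 0)$ or $\operatorname{inertia}(X) = i\,(0, 0, n_2)$.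
   Context: For a skew-Hermitian matrix $B$ (whose eigenvalues are all purely imaginary), the notation $\operatorname{inertia}(B) = i\,(n_{-}, n_0, n_{+})$ means that, counting multiplicities, $B$ has $n_{-}$ eigenvalues on the negative part of the imaginary axis (of the form $i t$ with $t<0$), $n_0$ zero eigenvalues, and $n_{+}$ eigenvalues on the positive part of the imaginary axis (of the form $it$ with $t>0$). A square matrix $Y = (y_{ij})$ of order $m$ is lower antitriangular if $y_{ij} = 0$ whenever $i + j \le m$. ${}^{\ast}$ denotes the conjugate transpose. Blocks of order $0$ are allowed (and are simply absent); the ''either/or'' on the inertia of $X$ is inclusive, the two alternatives coinciding when $n_2=0$. *)

(* Defs.v *)
From HB Require Import structures.
From mathcomp Require Import all_boot all_order all_algebra.
From mathcomp Require Import spectral sesquilinear.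
From mathcomp Require Import reals complex.

Set Implicit Arguments.
Unset Strict Implicit.
Unset Printing Implicit Defensive.

Import Order.TTheory GRing.Theory Num.Theory.
Local Open Scope ring_scope.
Local Open Scope sesquilinear_scope.

Definition skew_hermitian (R : realType) (m : nat) (B : 'M[R[i]]_m) : Prop :=
  B ^t* = - B.

(* In 0-based indices; in 1-based ones the condition reads i + j <= m. *)
Definition lower_antitriangular (R : realType) (m : nat) (Y : 'M[R[i]]_m) :
    Prop :=
  forall i j : 'I_m, (i.+1 + j.+1 <= m)%N -> Y i j = 0.

(* The roots of the characteristic polynomial, repeated according to their
   algebraic multiplicity. *)
Definition eigenvalues (R : realType) (m : nat) (B : 'M[R[i]]_m) : seq R[i] :=
  sval (closed_field_poly_normal (char_poly B)).

Lemma char_poly_eigenvalues (R : realType) (m : nat) (B : 'M[R[i]]_m) :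
  char_poly B = \prod_(z <- eigenvalues B) ('X - z%:P).
Proof.
rewrite /eigenvalues; case: closed_field_poly_normal => r /= {1}->.
by rewrite (monicP (char_poly_monic B)) scale1r.
Qed.

(* The triple (n_-, n_0, n_+) of the notation inertia(B) = i (n_-, n_0, n_+). *)
Definition inertia (R : realType) (m : nat) (B : 'M[R[i]]_m) :
    nat * nat * nat :=
  (count (fun z => (complex.Re z == 0) && (complex.Im z < 0)) (eigenvalues B),
   count (fun z => z == 0) (eigenvalues B),
   count (fun z => (complex.Re z == 0) && (0 < complex.Im z)) (eigenvalues B)).

(* Main.v *)
(* Diagonalise A in an orthonormal eigenbasis, kernel first, and pair n1
   eigenvalues on one side of 0 with the n1 eigenvalues on the other side.
   If e, f are paired unit eigenvectors with eigenvalues x, y, x / y < 0, there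
   are real weights s, c with s^2 + c^2 = 1 and s^2 x + c^2 y = 0: the unit
   vector s e + c f is isotropic for A, and c e - s f completes it to an
   orthonormal basis of the plane.  Listing the isotropic vectors, then the
   unpaired eigenvectors, then the complementary vectors in reverse order gives
   the required form, with Y antidiagonal, W and X diagonal, and Z = 0. *)
Require Import Defs.
From HB Require Import structures.
From mathcomp Require Import all_boot all_order all_fingroup all_algebra.
From mathcomp Require Import spectral sesquilinear.
From mathcomp Require Import reals complex.
From mathcomp Require Import ring zify.

Set Implicit Arguments.
Unset Strict Implicit.
Unset Printing Implicit Defensive.

Import Order.TTheory GRing.Theory Num.Theory.
Local Open Scope ring_scope.
Local Open Scope sesquilinear_scope.

(** * Unitary diagonalisation with eigenvalues in a prescribed order *)

Lemma char_poly_conj (F : fieldType) n (P A : 'M[F]_n) :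
  P \in unitmx -> char_poly (invmx P *m A *m P) = char_poly A.
Proof.
move=> Pu; rewrite /char_poly /char_poly_mx.
have -> : 'X%:M - map_mx polyC (invmx P *m A *m P) =
  map_mx polyC (invmx P) *m ('X%:M - map_mx polyC A) *m map_mx polyC P.
  rewrite mulmxBr mulmxBl scalar_mxC -[_ *m _ *m map_mx _ P]mulmxA -!map_mxM mulVmx //.
  by rewrite map_scalar_mx rmorph1 mulmx1.
rewrite !det_mulmx mulrC mulrA -det_mulmx -map_mxM mulmxV //.
by rewrite map_scalar_mx rmorph1 det1 mul1r.
Qed.

Lemma perm_mx_unitary (C : numClosedFieldType) n (s : 'S_n) :
  (perm_mx s : 'M[C]_n) \is unitarymx.
Proof.
apply/unitarymxP; rewrite tr_perm_mx map_perm_mx -perm_mxM mulgV.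
exact: perm_mx1.
Qed.

Lemma perm_conj_diag (C : numClosedFieldType) n (s : 'S_n) (d : 'rV[C]_n) :
  perm_mx s *m diag_mx d *m (perm_mx s) ^t* = diag_mx (\row_i d 0 (s i)).
Proof.
rewrite tr_perm_mx map_perm_mx -row_permE -col_permE.
by apply/matrixP=> i j; rewrite !mxE (inj_eq perm_inj).
Qed.

Lemma skew_hermitian_normal (C : numClosedFieldType) n (A : 'M[C]_n) :
  A ^t* = - A -> A \is normalmx.
Proof. by move=> hA; apply/normalmxP; rewrite hA mulmxN mulNmx. Qed.

Lemma perm_eigenvalues_conj (R : realType) n (P A : 'M[R[i]]_n) :
  P \in unitmx -> perm_eq (eigenvalues (invmx P *m A *m P)) (eigenvalues A).
Proof.
move=> Pu; apply: prod_XsubC_eq.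
by rewrite -[LHS]char_poly_eigenvalues -[RHS]char_poly_eigenvalues; exact: char_poly_conj.
Qed.

Lemma perm_eigenvalues_diag (R : realType) n (d : 'rV[R[i]]_n) :
  perm_eq (eigenvalues (diag_mx d)) [seq d 0 i | i : 'I_n].
Proof.
apply: prod_XsubC_eq; rewrite -char_poly_eigenvalues.
rewrite char_poly_trig ?diag_mx_is_trig // big_map big_enum /=.
by apply: eq_bigr => i _; rewrite mxE eqxx.
Qed.

(** The spectral theorem leaves the order of the diagonal unspecified. The diagonal entries and [s]
    are root lists of the same characteristic polynomial, hence permutations of each other, and a
    permutation matrix turns one order into the other. *)
Lemma spectral_perm (R : realType) n (A : 'M[R[i]]_n) (s : seq R[i]) :
    A \is normalmx -> perm_eq (eigenvalues A) s ->
  exists2 P : 'M[R[i]]_n, P \is unitarymx &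
    P *m A *m P ^t* = diag_mx (\row_i s`_i).
Proof.
move=> /orthomx_spectralP hA hs.
set P := spectralmx A in hA; set d := spectral_diag A in hA.
have Pu : P \is unitarymx := spectral_unitarymx A.
have Pinv := unitarymx_unit Pu.
have /tuple_permP[p sE] : perm_eq s [tuple d 0 i | i < n].
  rewrite -(permPl hs) hA (permPl (perm_eigenvalues_conj _ Pinv)).
  exact: perm_eigenvalues_diag.
exists (perm_mx p *m P); first exact/mul_unitarymx/Pu/perm_mx_unitary.
rewrite {1}hA trmx_mul map_mxM !mulmxA invmx_unitary //.
rewrite mulmxtVK // mulmxtVK // perm_conj_diag; congr diag_mx.
apply/rowP => i; rewrite !mxE sE (nth_map i) ?size_enum_ord //.
by rewrite nth_ord_enum tnth_mktuple.
Qed.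

Lemma size_eigenvalues (R : realType) n (A : 'M[R[i]]_n) : size (eigenvalues A) = n.
Proof.
by have := size_char_poly A; rewrite char_poly_eigenvalues size_prod_XsubC => -[].
Qed.

(** A unitary diagonalisation of [A] is still skew-Hermitian, so conjugation negates each diagonal
    entry. *)
Lemma skew_hermitian_eigenvalue (R : realType) n (A : 'M[R[i]]_n) z :
  skew_hermitian A -> z \in eigenvalues A -> z^* = - z.
Proof.
move=> hA zA; have [P Pu PA] := spectral_perm (skew_hermitian_normal hA) (perm_refl _).
have zn : (index z (eigenvalues A) < n)%N.
  by rewrite -[X in (_ < X)%N](size_eigenvalues A) index_mem.
have := congr1 (fun M => M ^t* (Ordinal zn) (Ordinal zn)) PA.
rewrite !trmx_mul !map_mxM trmxCK hA mulmxA mulmxN mulNmx PA !mxE eqxx !mulr1n /=.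
by rewrite nth_index // => ->.
Qed.

(** * Rotation of paired eigenvectors to isotropic vectors *)

(* The unit vector [s e + c f] is isotropic for [x e e^* + y f f^*]. *)
Lemma isotropic_weights (C : numClosedFieldType) (x y : C) : x / y < 0 ->
  exists s c : C, [/\ s^* = s, c^* = c, s * s + c * c = 1,
    s * x * s + c * y * c = 0 & s * c * (x - y) != 0].
Proof.
move=> r0; set r := x / y in r0.
have y0 : y != 0 by apply: contraTneq r0 => y0; rewrite /r y0 invr0 mulr0 ltxx.
have r1 : 0 < 1 - r by rewrite subr_gt0 (lt_trans r0).
have rn0 : 1 - r != 0 by rewrite gt_eqF.
have s0 : 0 < (1 - r)^-1 by rewrite invr_gt0.
have c0 : 0 < - r / (1 - r) by rewrite divr_gt0 // oppr_gt0.
(* The equations s^2 + c^2 = 1 and s^2 r + c^2 = 0 force s^2 = 1 / (1 - r) and c^2 = - r / (1 - r).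
   Both are positive because r < 0, so the square roots are real. *)
exists (sqrtC (1 - r)^-1), (sqrtC (- r / (1 - r))).
have ss := sqrtCK (1 - r)^-1; have cc := sqrtCK (- r / (1 - r)).
have xE : x = r * y by rewrite divfK.
split.
- by apply/CrealP; rewrite realE sqrtC_ge0 ltW.
- by apply/CrealP; rewrite realE sqrtC_ge0 ltW.
- by rewrite -!expr2 ss cc; field.
- by rewrite ![_ * sqrtC _]mulrAC -!expr2 ss cc xE; field.
- rewrite !mulf_neq0 //.
  + by rewrite sqrtC_eq0 gt_eqF.
  + by rewrite sqrtC_eq0 gt_eqF.
  + rewrite xE -[X in _ - X]mul1r -mulrBl mulf_neq0 //.
    by rewrite subr_eq0 lt_eqF // (lt_trans r0).
Qed.

(** All pairs are rotated at once, with the kernel block left aside: [x] and [y] hold the paired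
    eigenvalues, [z] the unpaired ones. *)
Lemma antidiagonal_conj (C : numClosedFieldType) n1 n2
    (x y : 'rV[C]_n1) (z : 'rV[C]_n2) :
    (forall k, (x 0 k)^* = - x 0 k) -> (forall k, (y 0 k)^* = - y 0 k) ->
    (forall k, x 0 k / y 0 k < 0) ->
  exists (G : 'M[C]_(n1 + (n2 + n1))) (Y W : 'M[C]_n1),
    [/\ G \is unitarymx,
        G *m diag_mx (row_mx x (row_mx z y)) *m G ^t* =
          block_mx 0 (row_mx 0 (- Y ^t*))
                   (col_mx 0 Y) (block_mx (diag_mx z) 0 0 W),
        Y \in unitmx,
        (forall i j : 'I_n1, (i.+1 + j.+1 <= n1)%N -> Y i j = 0) &
        W ^t* = - W].
Proof.
move=> xC yC xy.
have /fin_all_exists[s /fin_all_exists[c sc]] :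
  forall k, exists s c : C, [/\ s^* = s, c^* = c, s * s + c * c = 1,
    s * x 0 k * s + c * y 0 k * c = 0 & s * c * (x 0 k - y 0 k) != 0].
  by move=> k; exact: isotropic_weights.
(* Diagonal matrices given by functions turn the block identities below into scalar identities at
   each index. *)
pose dg (f : 'I_n1 -> C) := diag_mx (\row_k f k).
have dgM f g : dg f *m dg g = dg (fun k => f k * g k).
  by rewrite mulmx_diag; congr diag_mx; apply/rowP=> k; rewrite !mxE.
have dgD f g : dg f + dg g = dg (fun k => f k + g k).
  by rewrite -raddfD; congr diag_mx; apply/rowP=> k; rewrite !mxE.
have dgN f : - dg f = dg (fun k => - f k).
  by rewrite -linearN; congr diag_mx; apply/rowP=> k; rewrite !mxE.
have dgC f : (dg f) ^t* = dg (fun k => (f k)^*).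
  by rewrite tr_diag_mx map_diag_mx; congr diag_mx; apply/rowP=> k; rewrite !mxE.
have dgE f g : f =1 g -> dg f = dg g.
  by move=> fg; congr diag_mx; apply/rowP=> k; rewrite !mxE.
have xE : diag_mx x = dg (x 0) by congr diag_mx; apply/rowP=> k; rewrite mxE.
have yE : diag_mx y = dg (y 0) by congr diag_mx; apply/rowP=> k; rewrite mxE.
have dg1 f : f =1 (fun _ => 1) -> dg f = 1%:M.
  by move=> f1; apply/matrixP=> i j; rewrite !mxE f1.
have dg0 f : f =1 (fun _ => 0) -> dg f = 0.
  by move=> f0; apply/matrixP=> i j; rewrite !mxE f0 mul0rn.
have sC : (dg s) ^t* = dg s by rewrite dgC; apply: dgE => k; case: (sc k).
have cC : (dg c) ^t* = dg c by rewrite dgC; apply: dgE => k; case: (sc k).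
(* The reversal permutation, which moves a diagonal block onto the antidiagonal. *)
pose J : 'M[C]_n1 := perm_mx (perm rev_ord_inj).
have JJ : J *m J ^t* = 1%:M by apply/unitarymxP/perm_mx_unitary.
(* The vectors c e - s f, in reverse order, paired by the form with the vectors s e + c f for [Y]
   and among themselves for [W]. *)
pose Y := J *m dg (fun k => c k * x 0 k * s k - s k * y 0 k * c k).
pose W := J *m dg (fun k => c k * x 0 k * c k + s k * y 0 k * s k) *m J ^t*.
(* The block rows are s e + c f, then the unpaired vectors, then c e - s f reversed, in eigenvector
   coordinates. *)
pose G : 'M[C]_(n1 + (n2 + n1)) :=
  block_mx (dg s) (row_mx 0 (dg c))
           (col_mx 0 (J *m dg c)) (block_mx 1%:M 0 0 (- (J *m dg s))).
have GC : G ^t* = block_mx (dg s) (row_mx 0 (dg c *m J ^t*))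
           (col_mx 0 (dg c)) (block_mx 1%:M 0 0 (- (dg s *m J ^t*))).
  rewrite tr_block_mx tr_col_mx tr_row_mx tr_block_mx map_block_mx.
  rewrite map_row_mx map_col_mx map_block_mx !trmx0 !map_mx0 trmx1 map_mx1.
  by rewrite linearN /= map_mxN !trmx_mul !map_mxM sC cC.
have scl : dg s *m dg s + dg c *m dg c = 1%:M.
  by rewrite !dgM dgD; apply: dg1 => k; case: (sc k).
have simp := (@mul0mx C, @mulmx0 C, @mul1mx C, @mulmx1 C, @mulNmx C, @mulmxN C,
  @add0r, @addr0, @oppr0, @opprK, @row_mx0, @col_mx0).
exists G, Y, W; split.
- apply/unitarymxP; rewrite GC mulmx_block.
  rewrite !(mul_row_col, mul_row_block, mul_block_col, mul_col_row) ?mulmx_block.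
  rewrite !(mul_mx_row, mul_col_mx, mul_row_col, simp).
  rewrite !(add_row_mx, add_col_mx, add_block_mx, simp) scl.
  rewrite !mulmxA -!(mulmxA J) [dg s *m dg c]diag_mxC !subrr !simp.
  rewrite -mulmxDr -mulmxDl [_ + dg s *m _]addrC scl mul1mx JJ.
  by rewrite -block_mxEv -!scalar_mx_block.
- have -> : G *m diag_mx (row_mx x (row_mx z y)) =
      block_mx (dg s *m dg (x 0)) (row_mx 0 (dg c *m dg (y 0)))
        (col_mx 0 (J *m dg c *m dg (x 0)))
        (block_mx (diag_mx z) 0 0 (- (J *m dg s *m dg (y 0)))).
    rewrite !diag_mx_row xE yE mulmx_block.
    rewrite !(mul_row_block, mul_col_mx, mulmx_block, simp).
    by rewrite -block_mxEv.
  rewrite GC mulmx_block.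
  rewrite !(mul_row_col, mul_row_block, mul_block_col, mul_col_row) ?mulmx_block.
  rewrite !(mul_mx_row, mul_col_mx, mul_row_col, simp).
  rewrite !(add_row_mx, add_col_mx, add_block_mx, simp).
  (* Conjugation negates [x] and [y], which cancels the minus sign in front of [Y ^t*]. *)
  have -> : - Y ^t* =
      dg (fun k => s k * x 0 k * c k - c k * y 0 k * s k) *m J ^t*.
    rewrite trmx_mul map_mxM dgC -mulNmx dgN; congr (_ *m _).
    apply: dgE => k; case: (sc k) => sk ck _ _ _.
    rewrite rmorphB !rmorphM /= xC yC sk ck; ring.
  rewrite /Y /W -block_mxEv.
  rewrite !mulmxA -!(mulmxA J) !dgM.
  rewrite -mulmxDr -mulmxBr -mulmxBl -mulmxDl !dgN !dgD.
  (* The leading block has diagonal entries s x s + c y c, zero by isotropy. *)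
  by rewrite dg0 => [//|k]; case: (sc k).
(* Up to the reversal, [Y] is diagonal with the nonzero entries s c (x - y). *)
- rewrite unitmx_mul unitarymx_unit ?perm_mx_unitary //= unitmxE det_diag.
  rewrite unitfE; apply/prodf_neq0 => k _; rewrite mxE.
  suff -> : c k * x 0 k * s k - s k * y 0 k * c k = s k * c k * (x 0 k - y 0 k).
    by case: (sc k).
  by ring.
(* Row [i] of [Y] meets the antidiagonal at j = n1 - (i + 1), where i.+1 + j.+1 = n1 + 1 just
   exceeds the bound. *)
- move=> i j ij; rewrite /Y -row_permE !mxE permE /=.
  case: eqP => [ji|_]; last by rewrite mulr0n.
  by move: ij; rewrite -ji addnS subnKC ?ltn_ord // ltnn.
- rewrite /W !trmx_mul !map_mxM trmxCK dgC mulmxA -[in RHS]mulNmx -mulmxN dgN.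
  congr (_ *m _ *m _); apply: dgE => k.
  case: (sc k) => sk ck _ _ _.
  rewrite rmorphD !rmorphM /= xC yC sk ck; ring.
Qed.

(** * Reduction for a given splitting of the spectrum *)

(** Here [u] stands for the sign with at least as many eigenvalues and [v] for the opposite one.
    Leaving open which is positive lets one argument cover both possible inertias of [X]. *)
Lemma antitriangular_reduction (R : realType) n0 n1 n2
    (A : 'M[R[i]]_(n0 + (n1 + (n2 + n1)))) (t u v : seq R[i]) :
    skew_hermitian A ->
    perm_eq (eigenvalues A) (t ++ u ++ v) ->
    size t = n0 -> size u = (n1 + n2)%N -> size v = n1 ->
    {in t, forall z, z = 0} -> {in u & v, forall x y, x / y < 0} ->
  exists (Q : 'M[R[i]]_(n0 + (n1 + (n2 + n1)))) (Y W : 'M[R[i]]_n1)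
      (d : 'rV[R[i]]_n2),
    [/\ Q \is unitarymx,
        Q ^t* *m A *m Q =
          block_mx 0 0
                   0 (block_mx 0 (row_mx 0 (- Y ^t*))
                               (col_mx 0 Y) (block_mx (diag_mx d) 0 0 W)),
        Y \in unitmx, lower_antitriangular Y &
        skew_hermitian W /\ forall k, d 0 k \in u].
Proof.
move=> hA hs st su sv t0 uv.
(* The first [n1] members of [u] get paired with [v]; the remaining [n2] form the middle diagonal
   block. *)
pose s := t ++ take n1 u ++ drop n1 u ++ v.
have ss : perm_eq (eigenvalues A) s by rewrite /s [take n1 u ++ _]catA cat_take_drop.
have [P Pu PA] := spectral_perm (skew_hermitian_normal hA) ss.
pose x : 'rV[R[i]]_n1 := \row_k u`_k.
pose z : 'rV[R[i]]_n2 := \row_k u`_(n1 + k).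
pose y : 'rV[R[i]]_n1 := \row_k v`_k.
have xu k : x 0 k \in u by rewrite mxE mem_nth // su ltn_addr.
have zu k : z 0 k \in u by rewrite mxE mem_nth // su ltn_add2l.
have yv k : y 0 k \in v by rewrite mxE mem_nth // sv.
have szt : size (take n1 u) = n1 by rewrite size_takel // su leq_addr.
have szd : size (drop n1 u) = n2 by rewrite size_drop su addKn.
have sE : \row_(i < n0 + (n1 + (n2 + n1))) s`_i = row_mx 0 (row_mx x (row_mx z y)).
  apply/rowP => i; rewrite mxE /s nth_cat st.
  case: (split_ordP i) => k -> /=.
    by rewrite row_mxEl mxE; apply/t0/mem_nth; rewrite st.
  rewrite row_mxEr addKn nth_cat szt.
  case: (split_ordP k) => {i k} k -> /=.
    by rewrite row_mxEl mxE nth_take.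
  rewrite row_mxEr addKn nth_cat szd.
  case: (split_ordP k) => {k} k -> /=.
    by rewrite row_mxEl mxE nth_drop.
  by rewrite row_mxEr mxE addKn.
have skew a : a \in t ++ u ++ v -> a^* = - a.
  by rewrite -(perm_mem hs); exact: skew_hermitian_eigenvalue.
have [|||G [Y [W [Gu GE Yu Yanti Wskew]]]] := @antidiagonal_conj _ n1 n2 x y z.
- by move=> k; apply: skew; rewrite !mem_cat xu orbT.
- by move=> k; apply: skew; rewrite !mem_cat yv !orbT.
- by move=> k; apply: uv.
(* The kernel vectors stay fixed; only their complement is rotated by [G]. *)
pose H : 'M[R[i]]_(n0 + (n1 + (n2 + n1))) := block_mx 1%:M 0 0 G.
have HC : H ^t* = block_mx 1%:M 0 0 (G ^t*).
  by rewrite tr_block_mx map_block_mx !trmx0 !map_mx0 trmx1 map_mx1.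
have Hu : H \is unitarymx.
  apply/unitarymxP; rewrite HC mulmx_block !mul0mx !mulmx0 mulmx1 !addr0 add0r.
  by rewrite (unitarymxP Gu) -scalar_mx_block.
have HPu := mul_unitarymx Hu Pu.
(* [P] acts as P A P^*, whereas the conclusion has Q^* A Q; hence the conjugate transpose. *)
exists ((H *m P) ^t*), Y, W, z; split;
  [by rewrite trmxC_unitary| |exact: Yu|exact: Yanti|by split].
rewrite trmxCK trmx_mul map_mxM -!mulmxA (mulmxA A) (mulmxA P) (mulmxA P) PA.
rewrite sE diag_mx_row HC linear0 !mulmx_block !(mul0mx, mulmx0, addr0, add0r).
by rewrite mulmxA GE.
Qed.

(** * Signs of imaginary eigenvalues and inertia of diagonal matrices *)

Lemma conj_oppE (R : realType) (z : R[i]) : z^* = - z -> complex.Re z = 0.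
Proof.
case: z => a b /(congr1 (@complex.Re R)) /= ab.
by apply/eqP; rewrite -[_ == 0](mulrn_eq0 a 2) mulr2n {1}ab addNr.
Qed.

(** Negativity in [R[i]] requires a real quotient; it is real because the factors i cancel, and its
    sign is that of the product of the imaginary parts. *)
Lemma imaginary_div_lt0 (R : realType) (x y : R[i]) :
    complex.Re x = 0 -> complex.Re y = 0 -> complex.Im x * complex.Im y < 0 ->
  x / y < 0.
Proof.
case: x y => [a b] [a' b'] /= -> -> bb.
have b'0 : b' != 0 by apply: contraTneq bb => ->; rewrite mulr0 ltxx.
have imE (c : R) : Complex 0 c = (c%:C * 'i)%C by rewrite [LHS]complexE /= add0r mulrC.
have -> : Complex 0 b / Complex 0 b' = (b / b')%:C%C.
  rewrite !imE -mulf_div divff ?mulr1 -?fmorph_div //.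
  by apply/eqP => -[] /eqP; rewrite oner_eq0.
rewrite -[0]/(0%:C)%C ltcR.
have -> : b / b' = b * b' / b' ^+ 2 by field.
by rewrite pmulr_llt0 // invr_gt0 exprn_even_gt0.
Qed.

(** [eigenvalues] has an unspecified order, but counts depend on a list only up to permutation. *)
Lemma inertia_diag (R : realType) n (d : 'rV[R[i]]_n) :
  let s := [seq d 0 k | k : 'I_n] in
  inertia (diag_mx d) =
    (count (fun z => (complex.Re z == 0) && (complex.Im z < 0)) s,
     count (fun z => z == 0) s,
     count (fun z => (complex.Re z == 0) && (0 < complex.Im z)) s).
Proof. by rewrite /inertia !(seq.permP (perm_eigenvalues_diag d)). Qed.

Lemma inertia_diag_pos (R : realType) n (d : 'rV[R[i]]_n) :
    (forall k, (complex.Re (d 0 k) == 0) && (0 < complex.Im (d 0 k))) ->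
  inertia (diag_mx d) = (0, 0, n)%N.
Proof.
move=> dP; rewrite inertia_diag !count_map.
rewrite [X in (_, _, X)](@eq_count _ _ predT) => [|k /=]; last exact: dP.
rewrite [X in (_, X, _)](@eq_count _ _ pred0) => [|k /=]; last first.
  by apply/eqP => dk; have := dP k; rewrite dk ltxx andbF.
rewrite [X in (X, _, _)](@eq_count _ _ pred0) => [|k /=]; last first.
  by have /andP[_ h] := dP k; rewrite ltNge ltW // andbF.
by rewrite !count_pred0 count_predT -enumT size_enum_ord.
Qed.

Lemma inertia_diag_neg (R : realType) n (d : 'rV[R[i]]_n) :
    (forall k, (complex.Re (d 0 k) == 0) && (complex.Im (d 0 k) < 0)) ->
  inertia (diag_mx d) = (n, 0, 0)%N.
Proof.
move=> dP; rewrite inertia_diag !count_map.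
rewrite [X in (X, _, _)](@eq_count _ _ predT) => [|k /=]; last exact: dP.
rewrite [X in (_, X, _)](@eq_count _ _ pred0) => [|k /=]; last first.
  by apply/eqP => dk; have := dP k; rewrite dk ltxx andbF.
rewrite [X in (_, _, X)](@eq_count _ _ pred0) => [|k /=]; last first.
  by have /andP[_ h] := dP k; rewrite ltNge ltW // andbF.
by rewrite !count_pred0 count_predT -enumT size_enum_ord.
Qed.

(** A nonzero number with zero real part has a positive or a negative imaginary part, so the three
    filters are disjoint and exhaust the list. *)
Lemma perm_sign_split (R : realType) (s : seq R[i]) :
    {in s, forall z, complex.Re z = 0} ->
  perm_eq s ([seq z <- s | z == 0] ++
             [seq z <- s | (complex.Re z == 0) && (0 < complex.Im z)] ++
             [seq z <- s | (complex.Re z == 0) && (complex.Im z < 0)]).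
Proof.
move=> s0; have eq_perm (a b : seq R[i]) : a = b -> perm_eq a b by move=> ->.
rewrite perm_sym -(permPr (permEl (perm_filterC (fun z => z == 0) s))) perm_cat2l.
set r := filter (predC _) s.
rewrite -(permPr (permEl (perm_filterC (fun z => 0 < complex.Im z) r))) /r -!filter_predI.
by apply: perm_cat; apply/eq_perm/eq_in_filter => z /s0;
  case: z => a b /= ->; rewrite eq_complex /= !eqxx /= lt_neqAle eq_sym;
  case: ltgtP.
Qed.

(** * Choice of the majority sign *)

Theorem corollary5p2 (R : realType) (n : nat) (A : 'M[R[i]]_n)
    (hA : skew_hermitian A)
    (nm n0 np : nat) (hinertia : inertia A = (nm, n0, np))
    (hnm : nm <> n) (hnp : np <> n)
    (n1 n2 : nat) (hn1 : n1 = minn nm np) (hn2 : n2 = (maxn nm np - n1)%N) :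
  exists (e : (n0 + (n1 + (n2 + n1)))%N = n) (Q : 'M[R[i]]_n)
         (Y : 'M[R[i]]_n1) (X : 'M[R[i]]_n2)
         (Z : 'M[R[i]]_(n1, n2)) (W : 'M[R[i]]_n1),
    Q \is unitarymx /\
    Q ^t* *m A *m Q =
      castmx (e, e)
        (block_mx (0 : 'M_n0) 0
                  0           (block_mx (0 : 'M_n1)  (row_mx 0 (- Y ^t*))
                                        (col_mx 0 Y) (block_mx X (- Z ^t*)
                                                               Z W))) /\
    Y \in unitmx /\ lower_antitriangular Y /\
    skew_hermitian W /\ skew_hermitian X /\
    (inertia X = (n2, 0%N, 0%N) \/ inertia X = (0%N, 0%N, n2)).
Proof.
have Re0 z : z \in eigenvalues A -> complex.Re z = 0.
  by move=> /(skew_hermitian_eigenvalue hA); exact: conj_oppE.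
have := perm_sign_split Re0.
set t := [seq z <- _ | z == 0]; set p := [seq z <- _ | _]; set m := [seq z <- _ | _].
move=> evE.
have [sm st sp] : [/\ size m = nm, size t = n0 & size p = np].
  by case: hinertia; rewrite !size_filter.
have pP z : z \in p -> (complex.Re z == 0) && (0 < complex.Im z).
  by rewrite mem_filter => /andP[].
have mP z : z \in m -> (complex.Re z == 0) && (complex.Im z < 0).
  by rewrite mem_filter => /andP[].
have t0 : {in t, forall z, z = 0} by move=> z; rewrite mem_filter => /andP[/eqP].
have pm : {in p & m, forall x y, x / y < 0}.
  move=> x y /pP /andP[/eqP x0 xp] /mP /andP[/eqP y0 yn].
  by apply: imaginary_div_lt0; rewrite // pmulr_rlt0.
have mp : {in m & p, forall x y, x / y < 0}.
  move=> x y /mP /andP[/eqP x0 xn] /pP /andP[/eqP y0 yp].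
  by apply: imaginary_div_lt0; rewrite // nmulr_rlt0.
have sn : (n0 + (np + nm))%N = n.
  by rewrite -(size_eigenvalues A) (perm_size evE) !size_cat st sp sm.
(* With the minimum counted twice, n1 + (n2 + n1) = 2 min + (max - min) = nm + np. *)
have e : (n0 + (n1 + (n2 + n1)))%N = n.
  by rewrite -sn hn2 hn1; lia.
clear sn hnm hnp hinertia.
(* Once [n] is replaced by the sum of the block orders, the cast along [e] is trivial. *)
exists e; subst n.
(* Recording that all entries of [d] come from one sign class gives the inertia of [X]; the block
   [Z] is zero. *)
suff [Q [Y [W [d [Qu QE Yu Ya [Ws dI]]]]]] :
  exists (Q : 'M[R[i]]_(n0 + (n1 + (n2 + n1)))) (Y W : 'M[R[i]]_n1)
      (d : 'rV[R[i]]_n2),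
    [/\ Q \is unitarymx,
        Q ^t* *m A *m Q =
          block_mx 0 0
                   0 (block_mx 0 (row_mx 0 (- Y ^t*))
                               (col_mx 0 Y) (block_mx (diag_mx d) 0 0 W)),
        Y \in unitmx, lower_antitriangular Y &
        skew_hermitian W /\
        ((forall k, d 0 k \in p) \/ (forall k, d 0 k \in m))].
  exists Q, Y, (diag_mx d), 0, W; do !split=> //.
  - by rewrite castmx_id QE linear0 map_mx0 oppr0.
  - rewrite /skew_hermitian tr_diag_mx map_diag_mx -linearN; congr diag_mx.
    apply/rowP => k; rewrite !mxE; apply: (skew_hermitian_eigenvalue hA).
    by rewrite (perm_mem evE) !mem_cat; case: dI => ->; rewrite ?orbT.
  - case: dI => dI; [right; apply: inertia_diag_pos => k; exact: pP|].
    by left; apply: inertia_diag_neg => k; exact: mP.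
(* The majority sign supplies the unpaired eigenvalues: positive when nm <= np, negative
   otherwise. *)
have [le_mp|lt_pm] := leqP nm np.
- have [//| | |//|//|Q [Y [W [d [Qu QE Yu Ya [Ws dp]]]]]] :=
    @antitriangular_reduction _ n0 n1 n2 A t p m hA evE.
  + by rewrite sp; lia.
  + by rewrite sm; lia.
  by exists Q, Y, W, d; split; [..|split; [|left]].
- have evE' : perm_eq (eigenvalues A) (t ++ m ++ p).
    by rewrite (permPl evE) perm_cat2l perm_catC.
  have [//| | |//|//|Q [Y [W [d [Qu QE Yu Ya [Ws dm]]]]]] :=
    @antitriangular_reduction _ n0 n1 n2 A t m p hA evE'.
  + by rewrite sm; lia.
  + by rewrite sp; lia.
  by exists Q, Y, W, d; split; [..|split; [|right]].
Qed.
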